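(* For all positive integers $d$, $k$, and $l$ with $k>l$, there exists a divisor $c$ of $d$ such that \[ \alpha(\mathbb{Z}_d,\{k,l\}) \;\le\; \gamma(\mathbb{Z}_c,\{k,l\})\cdot\frac{d}{c}. \]
   Context: For a subset $A$ of $\mathbb{Z}_d$ and a positive integer $h$, $hA$ denotes the $h$-fold sumset $\{a_1+\cdots+a_h : a_i\in A\}$. For positive integers $k>l$, $A$ is $(k,l)$-sum-free if $kA\cap lA=\emptyset$. An arithmetic progression in $\mathbb{Z}_d$ is a set $\{a+i\cdot b : i=0,1,\dots,m-1\}$ with $m$ a positive integer, $a,b\in\mathbb{Z}_d$ and $m\le d/\gcd(d,b)$ (so it has exactly $m$ elements); when $m=1$ one takes $b=1$. $\alpha(\mathbb{Z}_d,\{k,l\})$ is the maximum size of a $(k,l)$-sum-free arithmetic progression in $\mathbb{Z}_d$, and $\gamma(\mathbb{Z}_c,\{k,l\})$ is the maximum size of a $(k,l)$-sum-free arithmetic progression in $\mathbb{Z}_c$ whose common difference $b$ satisfies $\gcd(b,c)=1$ (each taken to be $0$ if there is none). *)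

(* Defs.v *)
From mathcomp Require Import all_boot all_order all_algebra.

Set Implicit Arguments.
Unset Strict Implicit.
Unset Printing Implicit Defensive.

Import GRing.Theory.
Local Open Scope ring_scope.

(* ['Z_d] is Z/2 when d = 1, whereas 'I_d.-1.+1 is Z/dZ for every d > 0 (and is
   the trivial group for the irrelevant value d = 0). *)
Notation Zmod d := 'I_d.-1.+1.

Definition sumset (G : finZmodType) (h : nat) (A : {set G}) : {set G} :=
  [set \sum_(i < h) f i | f : {ffun 'I_h -> G} in ffun_on (mem A)].

Definition sum_free (G : finZmodType) (k l : nat) (A : {set G}) : bool :=
  sumset k A :&: sumset l A == set0.

Definition progression (G : finZmodType) (a b : G) (m : nat) : {set G} :=
  [set a + b *+ i | i : 'I_m].

(* gcd(d, b) is computed on the representative of b in [0, d); in particular it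
   is d for b = 0. The bound m <= d is implied by m <= d / gcd(d, b), so letting
   m range over 'I_d.+1 loses nothing. *)
Definition is_ap_diff (d : nat) (b : Zmod d) (A : {set Zmod d}) : bool :=
  [exists a : Zmod d, exists m : 'I_d.+1,
    [&& (0 < m)%N, (m <= d %/ gcdn d b)%N, (m == 1%N :> nat) ==> (b == inZp 1%N)
      & A == progression a b m]].

Definition is_ap (d : nat) (A : {set Zmod d}) : bool :=
  [exists b : Zmod d, is_ap_diff b A].

Definition is_coprime_ap (d : nat) (A : {set Zmod d}) : bool :=
  [exists b : Zmod d, coprime b d && is_ap_diff b A].

(* A maximum over an empty family is 0. *)
Definition alpha (d k l : nat) : nat :=
  \max_(A : {set Zmod d} | is_ap A && sum_free k l A) #|A|.

Definition gamma (c k l : nat) : nat :=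
  \max_(A : {set Zmod c} | is_coprime_ap A && sum_free k l A) #|A|.

(* Main.v *)
Require Import Defs.
From mathcomp Require Import all_boot all_order all_algebra.
From mathcomp Require Import zify.

(** Let [A = {a + i b : i <= m}] be an extremal progression, [g = gcd (d, b)] and
    [n = d / g]. If [g] does not divide [(k - l) a], then [{a mod g}] is
    [(k, l)]-sum-free in [Z_g], and [c = g] works because [#|A| <= d / g].
    Otherwise [(k - l) a = b t] in [Z_d] with [0 <= t < n], and sum-freeness of [A]
    forces [l m < t < n - k m]. Since [gcd (k - l, d)] divides both [b t] and [d t],
    it divides [g t], so [(k - l) a' = g t] in [Z_d] for some [a'], and
    [l m < g t < d - k m] makes [{a' + i : i <= m}] sum-free: [c = d] works. *)

(** Greedy splitting of [i] into [h] parts: each takes up to [m] of what remains, and truncated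
    subtraction makes it zero once [i] is exhausted. Hence every index up to [h * m] is a sum of [h]
    indices up to [m]. *)
Lemma sum_minn_sub (m i h : nat) :
  \sum_(j < h) minn m (i - j * m) = minn (h * m) i.
Proof.
elim: h => [|h IHh]; first by rewrite big_ord0 mul0n min0n.
rewrite big_ord_recr /= IHh; lia.
Qed.

Lemma sumset_progression (G : finZmodType) (a b : G) (h m : nat) :
  sumset h (progression a b m.+1) = progression (a *+ h)%R b (h * m).+1.
Proof.
apply/setP=> x; apply/imsetP/imsetP => [[f /ffun_onP fA ->]|[i _ ->]].
  have fP (j : 'I_h) : exists i : 'I_m.+1, f j == (a + b *+ i)%R.
    by have /imsetP[i _ ->] := fA j; exists i.
  pose e j := xchoose (fP j).
  have le_e : \sum_(j < h) e j <= h * m.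
    rewrite -[h in h * m]card_ord -sum_nat_const; apply: leq_sum => j _.
    by rewrite -ltnS.
  exists (Ordinal (le_e : _ < (h * m).+1)) => //=.
  rewrite -GRing.sumrMnr -[h in (a *+ h)%R]card_ord -GRing.sumr_const.
  rewrite -big_split; apply: eq_bigr => j _.
  exact/eqP/(xchooseP (fP j)).
exists [ffun j : 'I_h => (a + b *+ minn m (i - j * m))%R].
  apply/ffun_onP => j; rewrite ffunE.
  have lt_m : minn m (i - j * m) < m.+1 by rewrite ltnS geq_minl.
  by apply/imsetP; exists (Ordinal lt_m).
under eq_bigr => j _ do rewrite ffunE.
rewrite big_split /= GRing.sumr_const card_ord GRing.sumrMnr sum_minn_sub.
by rewrite (minn_idPr _) // -ltnS.
Qed.

Lemma sum_free_progressionP (p k l m : nat) (a b : 'I_p.+1) :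
  reflect (forall i j, i <= k * m -> j <= l * m ->
             a * k + b * i <> a * l + b * j %[mod p.+1])
          (sum_free k l (progression a b m.+1)).
Proof.
have valE h i : ((a *+ h + b *+ i)%R = (a * h + b * i) %% p.+1 :> nat).
  by rewrite !Zp_mulrn /= modnDm.
rewrite /sum_free !sumset_progression.
apply: (iffP idP) => [/eqP free i j le_i le_j eq_ij | free].
  have : (a *+ k + b *+ i)%R \in
      progression (a *+ k)%R b (k * m).+1 :&: progression (a *+ l)%R b (l * m).+1.
    rewrite inE; apply/andP; split; apply/imsetP.
      by exists (Ordinal (le_i : i < (k * m).+1)).
    exists (Ordinal (le_j : j < (l * m).+1)) => //.
    by apply: val_inj; apply: etrans (valE k i) (etrans eq_ij (esym (valE l j))).
  by rewrite free inE.
rewrite -subset0; apply/subsetP => x; rewrite inE.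
case/andP=> /imsetP[i _ ->] /imsetP[j _ eq_ij].
case: (free i j (ltn_ord i) (ltn_ord j)).
by rewrite -(valE k i) -(valE l j) eq_ij.
Qed.

(** The witness is [{a, a + 1, ..., a + m}], whose [m.+1] terms are distinct because [m < c]. *)
Lemma leq_gamma (c k l m a : nat) : m < c ->
  (forall i j, i <= k * m -> j <= l * m -> a * k + i <> a * l + j %[mod c]) ->
  m < gamma c k l.
Proof.
case: c => // p lt_m free.
pose B : {set Zmod p.+1} := progression (inZp a) (inZp 1) m.+1.
have cardB : #|B| = m.+1.
  rewrite card_in_imset ?card_ord // => i j _ _ /GRing.addrI.
  rewrite !Zp_mulrn => /(congr1 val) /=.
  rewrite !modnMml !mul1n !modn_small; first exact: val_inj.
    exact: leq_trans (ltn_ord j) lt_m.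
  exact: leq_trans (ltn_ord i) lt_m.
rewrite -cardB; apply: (@leq_bigmax_cond _ _ (fun A : {set Zmod p.+1} => #|A|)).
apply/andP; split.
  (* This covers [p = 0] too, where [inZp 1] is 0 and [gcd (0, 1) = 1]. *)
  have co1 : coprime (inZp 1 : Zmod p.+1) p.+1 by rewrite /= coprime_modl coprime1n.
  apply/existsP; exists (inZp 1); rewrite co1.
  apply/existsP; exists (inZp a).
  apply/existsP; exists (Ordinal (lt_m : m.+1 < p.+2)).
  by rewrite /= gcdnC (eqP co1) divn1 lt_m !eqxx implybT.
apply/sum_free_progressionP => i j le_i le_j /=.
move/eqP; rewrite -!(modnDm (_ * _)) !modnMml !modnDm !mul1n => /eqP.
exact: free.
Qed.

Lemma linear_congruence (b d x : nat) : 0 < d -> gcdn d b %| x ->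
  exists t, b * t = x %[mod d].
Proof.
move=> d_gt0 /dvdnP[q ->]; case: (Bezoutl b d_gt0) => u _ /dvdnP[v uv].
(* Bezout gives [gcdn d b + u * b = 0] modulo [d], so [- u * q] is a solution; [d.-1] stands for
   -1. *)
exists (u * d.-1 * q); apply/eqP; rewrite -(eqn_modDr (b * u * q)).
have -> : b * (u * d.-1 * q) + b * u * q = b * u * q * d.
  by rewrite -[in RHS](prednK d_gt0); lia.
have -> : q * gcdn d b + b * u * q = v * q * d by move: uv; lia.
by rewrite !modnMl.
Qed.

Lemma leq_gamma_mul (d k l m a b : nat) : 0 < d -> l < k -> m < d %/ gcdn d b ->
  (forall i j, i <= k * m -> j <= l * m ->
     a * k + b * i <> a * l + b * j %[mod d]) ->
  exists2 c : nat, c %| d & m < gamma c k l * (d %/ c).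
Proof.
move=> d_gt0 lt_lk; set g := gcdn d b; set n := d %/ g => lt_mn free.
have g_gt0 : 0 < g by rewrite gcdn_gt0 d_gt0.
have gn : g * n = d by rewrite mulnC divnK // dvdn_gcdl.
have [gdvd | gndvd] := boolP (g %| a * (k - l)); last first.
  exists g; first exact: dvdn_gcdl.
  apply: leq_trans lt_mn _; apply: leq_pmull.
  (* A single point suffices: [gamma g k l] is then positive, and the factor [d %/ g] is [n]. *)
  apply: (@leq_gamma g k l 0 a) => // i j.
  rewrite !muln0 !leqn0 => /eqP-> /eqP-> /eqP; rewrite !addn0.
  by rewrite eqn_mod_dvd ?leq_mul2l ?(ltnW lt_lk) ?orbT // -mulnBr (negPf gndvd).
have bn : b * n = 0 %[mod d].
  by apply/eqP; rewrite eqn_mod_dvd // subn0 -gn dvdn_mul // dvdn_gcdr.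
have [t [lt_tn bt]] : exists t, t < n /\ b * t = a * (k - l) %[mod d].
  (* Reducing modulo [n] is harmless since [b * n] vanishes modulo [d]. *)
  have [t0 bt0] := linear_congruence b d _ d_gt0 gdvd; exists (t0 %% n).
  split; first by rewrite ltn_mod; lia.
  have bt0E : b * t0 = t0 %/ n * (b * n) + b * (t0 %% n).
    by rewrite {1}(divn_eq t0 n) mulnDr mulnCA.
  by rewrite -bt0 bt0E -[RHS]modnDml -(modnMmr _ (b * n)) bn mod0n muln0 mod0n add0n.
have akE : a * k = a * l + b * t %[mod d].
  by rewrite -modnDmr bt modnDmr -mulnDr subnKC // ltnW.
(* Otherwise [a * k] itself is the element [a * l + b * t] of the [l]-fold sumset. *)
have lt_t : l * m < t.
  rewrite ltnNge; apply/negP => le_t.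
  by apply: (free 0 t) => //; rewrite muln0 addn0.
(* Otherwise [a * k + b * (n - t)], in the [k]-fold sumset, equals [a * l + b * n], that is
   [a * l]. *)
have lt_nt : k * m < n - t.
  rewrite ltnNge; apply/negP => le_nt.
  apply: (free (n - t) 0) => //; rewrite muln0 addn0.
  rewrite -modnDml akE modnDml -addnA -mulnDr subnKC ?(ltnW lt_tn) //.
  by rewrite -modnDmr bn mod0n addn0.
have dvd_gt : gcdn d (k - l) %| g * t.
  rewrite /g muln_gcdl dvdn_gcd dvdn_mulr ?dvdn_gcdl //=.
  have d0 : gcdn d (k - l) %| d := dvdn_gcdl _ _.
  move: (congr1 (modn^~ (gcdn d (k - l))) bt); rewrite !modn_dvdm // /dvdn => ->.
  by apply: dvdn_mull; apply: dvdn_gcdr.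
have [a' a'E] := linear_congruence _ _ _ d_gt0 dvd_gt.
exists d => //; rewrite divnn d_gt0 muln1.
apply: (@leq_gamma d k l m a') => [|i j le_i le_j].
  by apply: leq_trans lt_mn _; apply: leq_div.
have -> : a' * k = a' * l + (k - l) * a' by rewrite [(k - l) * _]mulnC -mulnDr subnKC // ltnW.
(* After cancelling [a' * l], a collision reads [g * t + i = j] modulo [d]; it is impossible because
   [j < g * t + i < d]. *)
rewrite -addnA => /eqP; rewrite eqn_modDl -modnDml a'E modnDml.
have le_gt : t <= g * t by rewrite leq_pmull.
have lt_j : j < g * t + i by clear -le_j lt_t le_gt; lia.
rewrite eqn_mod_dvd; last exact: ltnW.
have lt_d : g * t + i < d.
  have lt_i : t + i < n by clear -le_i lt_nt; lia.
  rewrite -gn (leq_trans _ (leq_mul (leqnn g) lt_i)) // mulnS mulnDr.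
  by clear -g_gt0; nia.
rewrite gtnNdvd ?subn_gt0 //.
exact: leq_ltn_trans (leq_subr _ _) lt_d.
Qed.

Theorem theorem12 (d k l : nat) (d_gt0 : 0 < d) (k_gt0 : 0 < k) (l_gt0 : 0 < l)
    (lt_l_k : l < k) :
  exists2 c : nat, c %| d & alpha d k l <= gamma c k l * (d %/ c).
Proof.
pose P (A : {set Zmod d}) := is_ap A && sum_free k l A.
(* With no admissible progression [alpha] is 0 and any divisor serves. *)
have [noA | someA] := posnP #|P|.
  by exists d => //; rewrite /alpha big_pred0 //; apply: card0_eq.
have [A] := @eq_bigmax_cond _ P (fun A => #|A|) someA.
rewrite /alpha => /andP[/existsP[b /existsP[a /existsP[[[|m] lt_m]]]]] //=.
case/and3P => le_m _ /eqP-> free ->.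
case: d d_gt0 a b lt_m le_m free {P A someA} => // p _ a b _ lt_m.
move/sum_free_progressionP => free.
have [c cd lt_c] := leq_gamma_mul _ _ _ _ _ _ (ltn0Sn p) lt_l_k lt_m free.
exists c => //; apply: leq_trans lt_c.
by apply: leq_trans (leq_imset_card _ _) _; rewrite card_ord.
Qed.
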